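(* Let $C$ be a closed convex subset of $\mathbb{R}^n$ with nonempty interior. Let $h\colon \mathbb{R}^n\to\mathbb{R}$ be a proper lower-semicontinuous convex function which is continuously differentiable on $C\subset \operatorname{int}(\operatorname{dom} h)$. Let $A$ be a (single-valued) monotone continuous operator defined on $C$. Consider the problem $$\text{find } \widehat{x}\in\mathbb{R}^n \text{ such that } 0\in A(\widehat{x})+\partial h(\widehat{x})+N_C(\widehat{x}). \qquad (P)$$ Let $x_0\in C$, let $(\gamma_k)_{k\in\mathbb{N}}$ be a sequence in $]0,+\infty[$, and let $(x_k)_{k\in\mathbb{N}}$ be generated by, for $k=0,1,\ldots$, $$a_k = A(x_k)+\nabla h(x_k),\qquad z_k=\operatorname{proj}_C(x_k-\gamma_k a_k),\qquad x_{k+1}=\operatorname{proj}_C\big(z_k-\gamma_k(A(z_k)+\nabla h(z_k)-a_k)\big).$$ Assume that (i) there exists a solution to (P); (ii) for every $k\in\mathbb{N}$, $\gamma_k$ satisfies the Armijo-Goldstein rule (recalled in the context) for $B=A+\nabla h$ and $f=\iota_C$. Then $(x_k)_{k\in\mathbb{N}}$ converges to a solution to (P), belonging to $\operatorname{dom} A$.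
   Context: $\mathbb{R}^n$ is equipped with its Euclidean norm $\|\cdot\|$ and inner product. $\partial h$ is the Moreau (convex) subdifferential of $h$. $\iota_C$ is the indicator function of $C$ ($0$ on $C$, $+\infty$ elsewhere). $\operatorname{proj}_C$ is the projector onto $C$, which equals the proximity operator of $\gamma\iota_C$ for any $\gamma>0$. The normal cone is $N_C(x)=\{u\in\mathbb{R}^n \mid \langle y-x\mid u\rangle\le 0 \text{ for all } y\in C\}$ if $x\in C$, and $N_C(x)=\varnothing$ otherwise. $A$ is defined on $C$, i.e. $\operatorname{dom}A=C$; it is monotone if $\langle A(x)-A(y)\mid x-y\rangle\ge 0$ for all $x,y\in C$. Armijo-Goldstein rule (for an operator $B$ and a function $f$): let $\sigma\in\,]0,+\infty[$ and $(\beta,\theta)\in\,]0,1[^2$ be fixed constants. At every iteration $k\in\mathbb{N}$, the stepsize $\gamma_k>0$ is chosen such that $\gamma_k=\sigma\beta^{i_k}$, where $$i_k=\inf\Big\{ i\in\mathbb{N} \;\Big|\; \gamma=\sigma\beta^i,\ \ z=\operatorname{prox}_{\gamma f}\big(x_k-\gamma B(x_k)\big),\ \ \gamma\|B(z)-B(x_k)\|\le\theta\|z-x_k\|\Big\}.$$ For $f=\iota_C$, $\operatorname{prox}_{\gamma f}=\operatorname{proj}_C$. *)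

(* Defs.v *)
From HB Require Import structures.
From mathcomp Require Import all_boot all_order all_algebra.
From mathcomp Require Import all_classical all_reals all_analysis.

Set Implicit Arguments.
Unset Strict Implicit.
Unset Printing Implicit Defensive.

Import Order.TTheory GRing.Theory Num.Theory.
Import numFieldNormedType.Exports.

Local Open Scope classical_set_scope.
Local Open Scope ring_scope.

(** R^n is ['rV[R]_n]. The library norm [`| _ |] on this type is the maximum
    norm. It induces the usual topology (and hence the usual notions of limit,
    interior and Frechet derivative), but every inequality between norms has to
    be written with the Euclidean norm [enorm] below. *)

Section Euclidean.
Context {R : realType} {n : nat}.
Local Notation V := 'rV[R]_n.

Definition dotp (u v : V) : R := \sum_(i < n) u ord0 i * v ord0 i.

Definition enorm (u : V) : R := Num.sqrt (dotp u u).

End Euclidean.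

Section ConvexAnalysis.
Context {R : realType} {n : nat}.
Local Notation V := 'rV[R]_n.
Local Open Scope ereal_scope.

Definition effective_dom (f : V -> \bar R) : set V := [set x | f x < +oo].

Definition proper_fun (f : V -> \bar R) : Prop :=
  (forall x, f x != -oo) /\ effective_dom f !=set0.

(** For a function that never takes the value [-oo], so that no sum below is of
    the form [+oo - oo]. *)
Definition convex_efun (f : V -> \bar R) : Prop :=
  forall (x y : V) (t : R), (0 < t < 1)%R ->
    f (t *: x + (1 - t) *: y)%R <= t%:E * f x + (1 - t)%:E * f y.

(** If [f] is proper, this set is empty when [f x = +oo]. *)
Definition subdifferential (f : V -> \bar R) (x : V) : set V :=
  [set u | forall y, (dotp (y - x)%R u)%:E + f x <= f y].

Definition indicator_fun (C : set V) (x : V) : \bar R :=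
  if x \in C then 0 else +oo.

Definition normal_cone (C : set V) (x : V) : set V :=
  [set u | C x /\ forall y, C y -> (dotp (y - x) u <= 0)%R].

(** [projector] and [prox] pick a minimizer, which exists and is unique in the
    usual cases ([C] nonempty closed convex, [f] proper lower semicontinuous convex);
    the default value [x] is otherwise irrelevant. *)
Definition projector (C : set V) (x : V) : V :=
  xget x [set p | C p /\ forall y, C y -> (enorm (x - p) <= enorm (x - y))%R].

Definition prox (f : V -> \bar R) (x : V) : V :=
  xget x [set p | forall y,
    f p + (2^-1 * enorm (x - p) ^+ 2)%:E <= f y + (2^-1 * enorm (x - y) ^+ 2)%:E].

(** The vector of partial derivatives of the real-valued function [fine \o f];
    it is meaningful at points of the interior of the effective domain. *)
Definition grad (f : V -> \bar R) (x : V) : V :=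
  \row_(j < n) 'D_(delta_mx ord0 j : V) (fun y : V => fine (f y)) x.

Definition continuously_differentiable_on (C : set V) (f : V -> \bar R) : Prop :=
  (forall x, C x -> differentiable (fun y : V => fine (f y)) x) /\
  {within C, continuous (grad f)}.

End ConvexAnalysis.

Section Operators.
Context {R : realType} {n : nat}.
Local Notation V := 'rV[R]_n.

Definition op_dom (M : V -> set V) : set V := [set x | M x !=set0].

Definition op_add (M N : V -> set V) (x : V) : set V :=
  [set w | exists u v, [/\ M x u, N x v & w = u + v]].

(** The at most single-valued operator with domain [C] that coincides with [A]
    on [C]; the values of the function [A] outside [C] are ignored. *)
Definition op_on (C : set V) (A : V -> V) (x : V) : set V :=
  [set u | C x /\ u = A x].

Definition monotone_on (C : set V) (A : V -> V) : Prop :=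
  forall x y, C x -> C y -> 0 <= dotp (A x - A y) (x - y).

Definition is_solution (C : set V) (A : V -> V) (h : V -> \bar R) (x : V) : Prop :=
  op_add (op_add (op_on C A) (subdifferential h)) (normal_cone C) x 0.

End Operators.

Section ArmijoGoldstein.
Context {R : realType} {n : nat}.
Local Notation V := 'rV[R]_n.

Definition armijo_test (theta : R) (B : V -> V) (f : V -> \bar R)
    (x : V) (gamma : R) : Prop :=
  let z := prox (fun y => (gamma%:E * f y)%E) (x - gamma *: B x) in
  gamma * enorm (B z - B x) <= theta * enorm (z - x).

(** The exponent is the infimum in the natural numbers of the set of admissible
    exponents, that is, its least element. When the set is empty the infimum
    is not a natural number and no stepsize satisfies the rule. *)
Definition armijo_goldstein (sigma beta theta : R) (B : V -> V)
    (f : V -> \bar R) (x : V) (gamma : R) : Prop :=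
  exists i : nat,
    [/\ gamma = sigma * beta ^+ i,
        armijo_test theta B f x (sigma * beta ^+ i) &
        forall j : nat, armijo_test theta B f x (sigma * beta ^+ j) ->
          (i <= j)%N].

End ArmijoGoldstein.

(* Main.v *)
Require Import Defs.
From HB Require Import structures.
From mathcomp Require Import all_boot all_order all_algebra.
From mathcomp Require Import all_classical all_reals all_analysis.
From mathcomp Require Import ring lra.

(** Put [B = A + grad h]. Since the gradient inequality makes [grad h x] a
    subgradient, solutions of (P) are obtained from the variational inequality
    [<B p, y - p> >= 0] for [y] in [C], and every solution [xs] satisfies
    [<B y, y - xs> >= 0] on [C]. With the Armijo-Goldstein bound this gives
      |x_{k+1} - xs|^2 <= |x_k - xs|^2 - (1 - theta^2) |z_k - x_k|^2,
    so [x_k] is bounded and [z_k - x_k] tends to [0]. Passing to the limit in the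
    projection inequality shows that every cluster point is a solution, even when
    the stepsizes tend to [0]; Fejer monotonicity with respect to that cluster
    point then gives convergence of the whole sequence. *)

Set Implicit Arguments.
Unset Strict Implicit.
Unset Printing Implicit Defensive.

Import Order.TTheory GRing.Theory Num.Theory.
Import numFieldNormedType.Exports.

Local Open Scope classical_set_scope.
Local Open Scope ring_scope.

(** * Euclidean inner product and norm, and their comparison with the maximum norm *)

Section EuclideanNorm.
Context {R : realType} {n : nat}.
Implicit Types u v w p q : 'rV[R]_n.

Lemma dotpC u v : dotp u v = dotp v u.
Proof. by apply: eq_bigr => i _; rewrite mulrC. Qed.

Lemma dotpDl u v w : dotp (u + v) w = dotp u w + dotp v w.
Proof. by rewrite /dotp -big_split; apply: eq_bigr => i _; rewrite mxE mulrDl. Qed.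

Lemma dotpDr u v w : dotp w (u + v) = dotp w u + dotp w v.
Proof. by rewrite dotpC dotpDl !(dotpC w). Qed.

Lemma dotpZl c u v : dotp (c *: u) v = c * dotp u v.
Proof. by rewrite /dotp mulr_sumr; apply: eq_bigr => i _; rewrite mxE mulrA. Qed.

Lemma dotpZr c u v : dotp u (c *: v) = c * dotp u v.
Proof. by rewrite dotpC dotpZl dotpC. Qed.

Lemma dotpNl u v : dotp (- u) v = - dotp u v.
Proof. by rewrite -scaleN1r dotpZl mulN1r. Qed.

Lemma dotpNr u v : dotp u (- v) = - dotp u v.
Proof. by rewrite -scaleN1r dotpZr mulN1r. Qed.

Definition dotpE := (dotpDl, dotpDr, dotpNl, dotpNr, dotpZl, dotpZr).

Lemma dotp_ge0 u : 0 <= dotp u u.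
Proof. by apply: sumr_ge0 => i _; rewrite -expr2 sqr_ge0. Qed.

Lemma enorm_ge0 u : 0 <= enorm u.
Proof. exact: sqrtr_ge0. Qed.

Lemma sqr_enorm u : enorm u ^+ 2 = dotp u u.
Proof. by rewrite sqr_sqrtr ?dotp_ge0. Qed.

Lemma enormN u : enorm (- u) = enorm u.
Proof. by rewrite /enorm dotpNl dotpNr opprK. Qed.

Lemma enormB u v : enorm (u - v) = enorm (v - u).
Proof. by rewrite -enormN opprB. Qed.

Lemma enorm0 : enorm (0 : 'rV[R]_n) = 0.
Proof. by rewrite /enorm -(scale0r 0) dotpZl mul0r sqrtr0. Qed.

Lemma sqr_enormB u v :
  enorm (u - v) ^+ 2 = enorm u ^+ 2 - 2 * dotp u v + enorm v ^+ 2.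
Proof. by rewrite !sqr_enorm !dotpE (dotpC v u); ring. Qed.

Lemma norm_le_enorm u : `|u| <= enorm u.
Proof.
rewrite [leLHS]/Num.norm/= mx_normrE; apply/bigmax_leP; split=> [|[i j] _ /=].
  exact: enorm_ge0.
rewrite -sqrtr_sqr ler_wsqrtr// (ord1 i) /dotp (bigD1 j)//= -expr2 lerDl.
by apply: sumr_ge0 => k _; rewrite -expr2 sqr_ge0.
Qed.

Lemma coord_le_norm u i : `|u ord0 i| <= `|u|.
Proof.
by rewrite [leRHS]/Num.norm/= mx_normrE; apply/bigmax_geP; right; exists (ord0, i).
Qed.

Lemma enorm_le_norm u : enorm u <= Num.sqrt n%:R * `|u|.
Proof.
rewrite -[X in _ * X](ger0_norm (normr_ge0 _)) -sqrtr_sqr -sqrtrM ?ler0n//.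
apply: ler_wsqrtr.
apply: (@le_trans _ _ (\sum_(i < n) `|u| ^+ 2)); last first.
  by rewrite sumr_const card_ord mulr_natl.
apply: ler_sum => i _; rewrite -expr2 -real_normK ?num_real//.
by rewrite lerXn2r ?nnegrE ?coord_le_norm.
Qed.

Lemma enorm_eq0 u : enorm u = 0 -> u = 0.
Proof.
move=> u0; apply/eqP; rewrite -normr_le0 -u0; exact: norm_le_enorm.
Qed.

Lemma dotp_le_enorm u v : dotp u v <= enorm u * enorm v.
Proof.
have [->|u0] := eqVneq u 0; first by rewrite enorm0 -(scale0r 0) dotpZl !mul0r.
have [->|v0] := eqVneq v 0; first by rewrite enorm0 -(scale0r 0) dotpZr mulr0 mul0r.
have pos w : w != 0 -> 0 < enorm w.
  by move=> w0; rewrite lt_def enorm_ge0 andbT; apply: contra_neq w0; exact: enorm_eq0.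
(* Expanding this square gives the Cauchy-Schwarz inequality multiplied by [enorm u * enorm v],
   which is positive here. *)
have := dotp_ge0 (enorm v *: u - enorm u *: v).
rewrite !dotpE -!sqr_enorm (dotpC v u) => uv.
rewrite -(ler_pM2l (mulr_gt0 (pos _ u0) (pos _ v0))).
move: uv; set a := enorm u; set b := enorm v; set c := dotp u v => uv.
lra.
Qed.

Lemma enormD u v : enorm (u + v) <= enorm u + enorm v.
Proof.
rewrite -(@ler_pXn2r _ 2)// ?nnegrE ?addr_ge0 ?enorm_ge0//.
rewrite sqr_enorm !dotpE (dotpC v u) -!sqr_enorm.
by have := dotp_le_enorm u v; lra.
Qed.

(** Equivalence of the two norms lets Euclidean balls serve as a neighbourhood basis of the topology
    induced by the maximum norm. *)
Lemma nbhs_enormP p (U : set 'rV[R]_n) :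
  nbhs p U <-> exists2 e, 0 < e & forall q, enorm (q - p) < e -> U q.
Proof.
split=> [/nbhs_ballP[e /= e0 eU]|[e e0 eU]].
  exists e => // q qp; apply: eU; rewrite -ball_normE/= distrC.
  exact: le_lt_trans (norm_le_enorm _) qp.
(* Adding 1 keeps the divisor positive when [n = 0]. *)
have n0 : 0 < Num.sqrt n%:R + 1 :> R by rewrite ltr_wpDl ?sqrtr_ge0.
apply/nbhs_ballP; exists (e / (Num.sqrt n%:R + 1)); first by rewrite /= divr_gt0.
move=> q; rewrite -ball_normE/= ltr_pdivlMr// => pq; apply: eU; rewrite enormB.
apply: le_lt_trans (enorm_le_norm _) (le_lt_trans _ pq).
by rewrite mulrC ler_wpM2l// lerDl.
Qed.

Lemma within_continuous_enormP (C : set 'rV[R]_n) (B : 'rV[R]_n -> 'rV[R]_n) p :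
  {within C, continuous B} -> C p -> forall e, 0 < e ->
  exists2 d, 0 < d &
    forall q, C q -> enorm (q - p) < d -> enorm (B q - B p) < e.
Proof.
move=> /subspace_continuousP cB Cp e e0.
have /cB : nbhs (B p) [set w | enorm (w - B p) < e].
  by apply/nbhs_enormP; exists e.
move=> /(_ Cp); rewrite nbhs_simpl/= /within/= => /nbhs_enormP[d d0 dB].
by exists d => // q Cq pq; exact: dB.
Qed.

Lemma enorm_dist_continuous v : continuous (fun u : 'rV[R]_n => enorm (u - v)).
Proof.
move=> p U /nbhs_ballP[e /= e0 eU]; apply/nbhs_enormP; exists e => // q qp.
apply: eU; rewrite -ball_normE/= ltr_norml.
have := enormD (q - p) (p - v); have := enormD (p - q) (q - v).
by rewrite !subrKA (enormB p q); move: qp; lra.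
Qed.

End EuclideanNorm.

(** * Projection onto a closed convex set *)

Section Projection.
Context {R : realType} {n : nat}.
Implicit Types (C : set 'rV[R]_n) (u v p q x y : 'rV[R]_n).

Lemma convex_set_segment C :
  convex_set (C : set (convex_lmodType 'rV[R]_n)) ->
  forall x y t, C x -> C y -> 0 <= t <= 1 -> C (x + t *: (y - x)).
Proof.
move=> cC x y t Cx Cy /andP[t0 t1].
have := cC y x (Itv01 t0 t1) (mem_set Cy) (mem_set Cx).
move/set_mem; rewrite /conv/= /unstable.onem; congr C.
by rewrite scalerBl scalerBr scale1r addrCA.
Qed.

Lemma compact_enorm_ball C x r :
  closed C -> compact (C `&` [set y | enorm (y - x) <= r]).
Proof.
move=> clC; apply: bounded_closed_compact.
  exists (r + enorm x); split; first exact: num_real.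
  move=> M rM y /= [_ yx]; apply: le_trans (norm_le_enorm _) _.
  apply: le_trans (ltW rM); rewrite -{1}(subrK x y).
  by apply: le_trans (enormD _ _) _; rewrite lerD2r.
apply: closedI => //.
apply: (@closed_comp _ _ (fun y => enorm (y - x)) [set t | t <= r]).
  by move=> y _; exact: enorm_dist_continuous.
exact: closed_le.
Qed.

(** The distance to [x] attains its minimum on the compact part of [C] no farther from [x] than a
    given point [c]; hence [xget] never returns its default value. *)
Lemma projectorP C x : closed C -> C !=set0 ->
  C (projector C x) /\
  forall y, C y -> enorm (x - projector C x) <= enorm (x - y).
Proof.
move=> clC [c Cc]; rewrite /projector.
suff [p Pp] : exists p, C p /\ forall y, C y -> enorm (x - p) <= enorm (x - y).
  by case: xgetP => [q _ //|/(_ p)/(_ Pp)].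
pose K := C `&` [set y | enorm (y - x) <= enorm (c - x)].
have K0 : K !=set0 by exists c; split => /=.
have cK : {within K, continuous (fun y => enorm (y - x))}.
  exact/continuous_subspaceT/enorm_dist_continuous.
have [p /set_mem[Cp pc] pmin] := EVT_min_rV K0 (compact_enorm_ball clC) cK.
exists p; split => // y Cy; rewrite enormB [leRHS]enormB.
have [yc|cy] := leP (enorm (y - x)) (enorm (c - x)).
  by apply: pmin; rewrite inE.
exact: le_trans pc (ltW cy).
Qed.

Lemma projector_obtuse C x y : closed C ->
  convex_set (C : set (convex_lmodType 'rV[R]_n)) -> C y ->
  dotp (x - projector C x) (y - projector C x) <= 0.
Proof.
move=> clC cC Cy; have [Cp pmin] := projectorP x clC (ex_intro _ y Cy).
move: Cp pmin; set p := projector C x => Cp pmin.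
set d := y - p; rewrite leNgt; apply/negP => a0.
have s0 : 0 < dotp (x - p) d + enorm d ^+ 2 + 1.
  by have := sqr_ge0 (enorm d); lra.
(* With [a] the inner product, assumed positive, and [D] the square of [enorm d], this [t] lies in
   ]0,1] and satisfies [t * D < a]. Minimality of [p] against [p + t *: d] would force
   [2 * a <= t * D]. *)
pose t := dotp (x - p) d / (dotp (x - p) d + enorm d ^+ 2 + 1).
have ta : t * (dotp (x - p) d + enorm d ^+ 2 + 1) = dotp (x - p) d.
  by rewrite divfK// gt_eqF.
have t0 : 0 < t by rewrite divr_gt0.
have t1 : t <= 1.
  by rewrite ler_pdivrMr// mul1r; have := sqr_ge0 (enorm d); lra.
have /pmin : C (p + t *: d) by apply: convex_set_segment => //; rewrite (ltW t0).
rewrite -(@ler_pXn2r _ 2)// ?nnegrE ?enorm_ge0// opprD addrA.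
rewrite [leRHS]sqr_enormB [enorm (t *: d) ^+ 2]sqr_enorm !(dotpZl, dotpZr).
rewrite -sqr_enorm; move: ta a0 t0.
move: (dotp (x - p) d) (enorm d ^+ 2) (sqr_ge0 (enorm d)) => a D D0 ta a0 t0 ineq.
have : 2 * a <= t * D by rewrite -(ler_pM2l t0); lra.
by have := mulr_gt0 t0 a0; lra.
Qed.

Lemma projector_dist_le C x y : closed C ->
  convex_set (C : set (convex_lmodType 'rV[R]_n)) -> C y ->
  enorm (projector C x - y) ^+ 2 <= enorm (x - y) ^+ 2.
Proof.
move=> clC cC Cy; have := projector_obtuse x clC cC Cy.
have -> : projector C x - y = (x - y) - (x - projector C x).
  by rewrite opprB [RHS]addrC subrKA.
have -> : y - projector C x = (x - projector C x) - (x - y).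
  by rewrite opprB [RHS]addrC subrKA.
rewrite sqr_enormB dotpDr dotpNr -sqr_enorm dotpC.
by have := sqr_ge0 (enorm (x - projector C x)); lra.
Qed.

(* For [gamma > 0], [gamma * +oo = +oo], so minimizers of the proximal objective
   lie in [C]. *)
Lemma prox_indicator C (gamma : R) x : 0 < gamma -> C !=set0 ->
  prox (fun y => (gamma%:E * indicator_fun C y)%E) x = projector C x.
Proof.
move=> g0 [c Cc]; rewrite /prox /projector; congr xget.
have inC y : C y -> (gamma%:E * indicator_fun C y = 0)%E.
  by move=> Cy; rewrite /indicator_fun mem_set// mule0.
have outC y : ~ C y -> (gamma%:E * indicator_fun C y = +oo)%E.
  by move=> Cy; rewrite /indicator_fun memNset// gt0_muley// lte_fin.
have le_half (s t : R) : 0 <= s -> 0 <= t ->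
    ((2^-1 * s ^+ 2)%:E <= (2^-1 * t ^+ 2)%:E)%E = (s <= t).
  by move=> s0 t0; rewrite lee_fin ler_pM2l ?invr_gt0// ler_pXn2r.
apply/seteqP; split=> [p /= pmin|p /= [Cp pmin] y].
  have Cp : C p.
    apply: contrapT => /outC Cp.
    by have := pmin c; rewrite Cp inC// add0e addye.
  split=> // y Cy; have := pmin y.
  by rewrite !inC// !add0e le_half ?enorm_ge0.
rewrite inC// add0e; have [Cy|/outC->] := pselect (C y).
  by rewrite inC// add0e le_half ?enorm_ge0// pmin.
by rewrite addye ?leey.
Qed.

End Projection.

(** * Gradients of convex functions as subgradients *)

Section Gradient.
Context {R : realType} {n : nat}.
Implicit Types (h : 'rV[R]_n -> \bar R) (x y v : 'rV[R]_n).

Lemma derive_grad h x v : differentiable (fun y => fine (h y)) x ->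
  'D_v (fun y => fine (h y)) x = dotp v (grad h x).
Proof.
move=> dh; rewrite deriveE// {1}(row_sum_delta v) linear_sum; apply: eq_bigr => j _.
by rewrite linearZ/= mxE deriveE.
Qed.

(** By convexity, the difference quotient from [x] towards [y] with step [t] in ]0,1[ is at most
    [h y - h x]; let [t] tend to 0 from the right. *)
Lemma grad_subdifferential h x : proper_fun h -> convex_efun h ->
  effective_dom h x -> differentiable (fun y => fine (h y)) x ->
  subdifferential h x (grad h x).
Proof.
move=> [hNy _] hconv hx dh y.
have finE z : (h z < +oo)%E -> h z = (fine (h z))%:E.
  by move=> hz; rewrite fineK// fin_numE hNy lt_eqF.
have [->|hy] := eqVneq (h y) +oo%E; first exact: leey.
have {}hy : (h y < +oo)%E by rewrite ltey.
rewrite -derive_grad// (finE _ hy) (finE _ hx) -EFinD lee_fin -lerBrDr.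
have /cvg_at_rightE cvgE : derivable (fun y => fine (h y)) x (y - x).
  exact: diff_derivable.
have cv : cvg ((t^-1 *: (((fun y => fine (h y)) \o shift x) (t *: (y - x)) -
    fine (h x))) @[t --> (0:R)^'+]).
  apply: cvgP; apply: cvg_dnbhs_at_right; exact: diff_derivable.
rewrite /derive cvgE; apply: limr_le => //.
near=> t.
have t0 : 0 < t by [].
have t1 : t < 1 by [].
have := hconv y x t; rewrite t0 t1 => /(_ isT).
have -> : t *: y + (1 - t) *: x = t *: (y - x) + x.
  by rewrite scalerBr scalerBl scale1r addrA addrAC.
rewrite (finE _ hy) (finE _ hx) -!EFinM -EFinD => hle.
(* The convexity bound itself shows that [h] is finite at the intermediate point. *)
move: (hle); rewrite finE ?(le_lt_trans hle) ?ltry// lee_fin => {}hle.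
rewrite /= ler_pdivrMl//; lra.
Unshelve. all: by end_near. Qed.

End Gradient.

(** * One step of the algorithm, and the variational inequality at cluster points *)

Section ForwardBackwardForward.
Context {R : realType} {n : nat}.
Context (C : set 'rV[R]_n) (B : 'rV[R]_n -> 'rV[R]_n) (C_closed : closed C)
  (C_convex : convex_set (C : set (convex_lmodType 'rV[R]_n))).
Implicit Types p q x y z : 'rV[R]_n.

(** The second projection does not increase the distance to [xs]. In the expanded squares, the
    obtuse-angle inequality for [z] controls the cross terms in [z - x] and [B x]; the remaining
    one, [- 2 * g * dotp (B z) (z - xs)], is nonpositive by hypothesis. *)
Lemma fbf_step x xs g : 0 < g -> C xs ->
  let z := projector C (x - g *: B x) in
  0 <= dotp (B z) (z - xs) ->
  enorm (projector C (z - g *: (B z - B x)) - xs) ^+ 2 <=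
    enorm (x - xs) ^+ 2 - enorm (z - x) ^+ 2 + (g * enorm (B z - B x)) ^+ 2.
Proof.
move=> g0 Cxs z zxs; apply: le_trans (projector_dist_le _ _ _ _) _ => //.
have := projector_obtuse (x - g *: B x) C_closed C_convex Cxs; rewrite -/z.
have -> : xs - z = - (z - xs) by rewrite opprB.
have -> : x - g *: B x - z = (x - z) - g *: B x by rewrite addrAC.
have -> : z - g *: (B z - B x) - xs = (z - xs) - g *: (B z - B x) by rewrite addrAC.
have -> : x - xs = (z - xs) - (z - x) by rewrite opprB [RHS]addrC subrKA.
have -> : x - z = - (z - x) by rewrite opprB.
rewrite !sqr_enormB exprMn.
have -> : enorm (g *: (B z - B x)) ^+ 2 = g ^+ 2 * enorm (B z - B x) ^+ 2.
  by rewrite !sqr_enorm dotpZl dotpZr; ring.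
move: (z - xs) (z - x) (B z) (B x) zxs => u v b a.
rewrite !dotpE (dotpC u v) (dotpC u b) (dotpC u a) => bu.
have := mulr_ge0 (ltW g0) bu; lra.
Qed.

(** The obtuse-angle inequality at [w], divided by [g], bounds [dotp (B x) (y - w)] from below. The
    residual must therefore be small relative to [g] as well, and then [g] needs no lower bound. *)
Lemma vi_of_small_residuals p :
  (forall e, 0 < e -> exists x g,
    let w := projector C (x - g *: B x) in
    [/\ 0 < g, enorm (x - p) <= e, enorm (B x - B p) <= e,
        enorm (w - x) <= e & enorm (w - x) <= g * e]) ->
  forall y, C y -> 0 <= dotp (B p) (y - p).
Proof.
move=> small y Cy.
(* The first summand collects the errors [b1] and [b2], where [e <= 1] gives the [+ 2]; the second
   comes from [b3]. *)
pose K := 2 * (enorm (y - p) + 2) + 2 * enorm (B p).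
have K0 : 0 < K.
  by have := enorm_ge0 (y - p); have := enorm_ge0 (B p); rewrite /K; lra.
suff approx e : 0 < e -> e <= 1 -> - (e * K) <= dotp (B p) (y - p).
  rewrite leNgt; apply/negP => lt0.
  pose a := - dotp (B p) (y - p).
  have a0 : 0 < a by rewrite oppr_gt0.
  have aK : 0 < a + K by lra.
  (* For [e = a / (a + K)], [e * K = a - e * a < a], which contradicts the approximate
     inequality. *)
  have e0 : 0 < a / (a + K) by rewrite divr_gt0.
  have e1 : a / (a + K) <= 1 by rewrite ler_pdivrMr//; lra.
  have := approx _ e0 e1; have := divfK (lt0r_neq0 aK) a.
  by have := mulr_gt0 e0 a0; rewrite -[dotp _ _]opprK -/a; lra.
move=> e0 e1; have [x [g]] := small _ e0.
set w := projector C _ => -[g0 xp Bxp wx wxg].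
have := projector_obtuse (x - g *: B x) C_closed C_convex Cy; rewrite -/w.
have -> : x - g *: B x - w = (x - w) - g *: B x by rewrite addrAC.
rewrite dotpDl dotpNl dotpZl => obt.
have yw : enorm (y - w) <= enorm (y - p) + 2.
  have -> : y - w = (y - p) + ((p - x) + (x - w)) by rewrite !subrKA.
  have := enormD (y - p) ((p - x) + (x - w)); have := enormD (p - x) (x - w).
  by rewrite (enormB p x) (enormB x w); lra.
have wp : enorm (w - p) <= 2 * e.
  have -> : w - p = (w - x) + (x - p) by rewrite subrKA.
  by have := enormD (w - x) (x - p); lra.
have b1 : - (e * enorm (y - w)) <= dotp (B x) (y - w).
  rewrite -(ler_pM2l g0).
  have := dotp_le_enorm (w - x) (y - w).
  have -> : w - x = - (x - w) by rewrite opprB.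
  rewrite dotpNl enormN -(enormB w x) => cs.
  by have := ler_wpM2r (enorm_ge0 (y - w)) wxg; lra.
have b2 : - (e * enorm (y - w)) <= dotp (B p - B x) (y - w).
  have := dotp_le_enorm (B x - B p) (y - w).
  have -> : B p - B x = - (B x - B p) by rewrite opprB.
  rewrite dotpNl.
  by have := ler_wpM2r (enorm_ge0 (y - w)) Bxp; lra.
have b3 : - (2 * e * enorm (B p)) <= dotp (B p) (w - p).
  have := dotp_le_enorm (- B p) (w - p).
  rewrite dotpNl enormN.
  by have := ler_wpM2l (enorm_ge0 (B p)) wp; lra.
have -> : dotp (B p) (y - p) =
    dotp (B x) (y - w) + dotp (B p - B x) (y - w) + dotp (B p) (w - p).
  by rewrite -dotpDl [B x + _]addrC subrK -dotpDr subrKA.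
by have := ler_wpM2l (ltW e0) yw; rewrite /K; lra.
Qed.

Context (B_continuous : {within C, continuous B})
  (sigma beta theta : R) (sigma_gt0 : 0 < sigma) (beta_01 : 0 < beta < 1)
  (theta_01 : 0 < theta < 1)
  (gamma : nat -> R) (x z : nat -> 'rV[R]_n) (x_C : forall k, C (x k))
  (z_def : forall k, z k = projector C (x k - gamma k *: B (x k)))
  (armijo : forall k, armijo_goldstein sigma beta theta B
     (indicator_fun C) (x k) (gamma k)).

(* At an iterate close to [p], either the stepsize is at least [delta] and can be
   used itself, or it is smaller than [sigma] and the rejected stepsize
   [gamma k / beta] is used: failure of the test there bounds the residual. *)
Lemma armijo_cluster_vi p : C p ->
  (forall e, 0 < e -> exists N, forall k, (N <= k)%N -> enorm (z k - x k) <= e) ->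
  (forall e N, 0 < e -> exists2 k, (N <= k)%N & enorm (x k - p) < e) ->
  forall y, C y -> 0 <= dotp (B p) (y - p).
Proof.
move=> Cp zx0 xp; apply: vi_of_small_residuals => e e0.
have /andP[b0 b1] := beta_01; have /andP[th0 th1] := theta_01.
(* If [B w] and [B (x k)] are both within [eta] of [B p], they differ by at most [theta * e]; the
   failed test then cancels [theta]. *)
pose eta := theta * e / 2.
have the0 : 0 < theta * e by rewrite mulr_gt0.
have thee : theta * e < e by rewrite gtr_pMl.
have eta0 : 0 < eta by rewrite divr_gt0.
have [d d0 Bd] := within_continuous_enormP B_continuous Cp eta0.
pose M := enorm (B p) + eta.
have M0 : 0 < M by have := enorm_ge0 (B p); rewrite /M; lra.
pose rho := Num.min (d / 2) e.
have rho0 : 0 < rho by rewrite lt_min e0 divr_gt0.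
have rhod : rho <= d / 2 by rewrite ge_min lexx.
have rhoe : rho <= e by rewrite ge_min lexx orbT.
(* If [gamma k < delta], the rejected stepsize [g = gamma k / beta] satisfies [g * M < rho]. Hence
   [w] is within [rho] of [x k], and within [d] of [p]. *)
pose delta := Num.min sigma (beta * rho / M).
have delta0 : 0 < delta by rewrite lt_min sigma_gt0 divr_gt0 ?mulr_gt0.
have delta_sigma : delta <= sigma by rewrite ge_min lexx.
have delta_rho : delta * M <= beta * rho.
  by rewrite -ler_pdivlMr// ge_min lexx orbT.
have [N zxN] : exists N, forall k, (N <= k)%N ->
    enorm (z k - x k) <= Num.min e (delta * e).
  by apply: zx0; rewrite lt_min e0 mulr_gt0.
have [k Nk xpk] := xp rho N rho0.
have {zxN} := zxN k Nk; rewrite le_min => /andP[zxe zxd].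
have Bxp : enorm (B (x k) - B p) < eta by apply: Bd => //; lra.
have [dg|gd] := leP delta (gamma k).
  exists (x k), (gamma k); rewrite /= -z_def; split.
  - exact: lt_le_trans dg.
  - by lra.
  - by move: Bxp; rewrite /eta; lra.
  - exact: zxe.
  by apply: le_trans zxd _; rewrite ler_pM2r.
have [i [gE _ imin]] := armijo k.
(* A zero exponent would give [gamma k = sigma >= delta]. *)
case: i gE imin => [|j] gE imin; first by move: gE; rewrite expr0; lra.
pose g := sigma * beta ^+ j.
have g0 : 0 < g by rewrite mulr_gt0// exprn_gt0.
have gb : beta * g = gamma k by rewrite gE exprS /g; ring.
exists (x k), g => /=; set w := projector C _.
have Cne : C !=set0 by exists p.
have Cw : C w by have [] := projectorP (x k - g *: B (x k)) C_closed Cne.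
have wx : enorm (w - x k) <= g * enorm (B (x k)).
  rewrite -(@ler_pXn2r _ 2)// ?nnegrE ?enorm_ge0//; last first.
    by apply: mulr_ge0; [exact: ltW|exact: enorm_ge0].
  apply: le_trans (projector_dist_le _ C_closed C_convex (x_C k)) _.
  rewrite addrAC subrr add0r enormN exprMn !sqr_enorm dotpZl dotpZr.
  by rewrite mulrA -expr2.
have BxM : enorm (B (x k)) <= M.
  have := enormD (B (x k) - B p) (B p); rewrite subrK /M; lra.
have wxrho : enorm (w - x k) < rho.
  apply: (le_lt_trans wx); rewrite -(ltr_pM2l b0) mulrA gb.
  apply: lt_le_trans delta_rho.
  apply: (@le_lt_trans _ _ (gamma k * M)); last by rewrite ltr_pM2r.
  by rewrite ler_wpM2l// -gb ltW// mulr_gt0.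
have Bwp : enorm (B w - B p) < eta.
  apply: Bd => //; have := enormD (w - x k) (x k - p).
  by rewrite subrKA; lra.
have Bwx : enorm (B w - B (x k)) <= theta * e.
  have := enormD (B w - B p) (B p - B (x k)).
  by rewrite subrKA (enormB (B p)); move: Bxp Bwp; rewrite /eta; lra.
split => //.
- by lra.
- by move: Bxp; rewrite /eta; lra.
- by lra.
(* Minimality of the exponent [j.+1] rejects [j], so [theta * enorm (w - x k) < g * enorm (B w - B
   (x k)) <= g * (theta * e)]. *)
have : ~ armijo_test theta B (indicator_fun C) (x k) g.
  by move=> /imin; rewrite ltnn.
rewrite /armijo_test prox_indicator// -/w => /negP; rewrite -ltNge => fail.
rewrite -(ler_pM2l th0).
by have := ler_wpM2l (ltW g0) Bwx; lra.
Qed.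

End ForwardBackwardForward.

(** The sequence [s] decreases and is bounded below, hence converges. Once two consecutive terms are
    within [c * e / 2] of the limit, [c * u k <= s k - s k.+1] is at most [c * e]. *)
Lemma descent_small (R : realType) (s u : nat -> R) (c : R) :
  0 < c -> (forall k, 0 <= s k) -> (forall k, 0 <= u k) ->
  (forall k, s k.+1 <= s k - c * u k) ->
  forall e, 0 < e -> exists N, forall k, (N <= k)%N -> u k <= e.
Proof.
move=> c0 s0 u0 sdec e e0.
have ninc : nonincreasing_seq s.
  apply/nonincreasing_seqP => k; have := sdec k; have := mulr_ge0 (ltW c0) (u0 k); lra.
have /cvgrPdist_lt scvg : cvgn s.
  by apply: nonincreasing_is_cvgn => //; exists 0 => _ [k _ <-].
have ce0 : 0 < c * e / 2 by rewrite divr_gt0 ?mulr_gt0.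
have [N _ sN] := scvg _ ce0.
exists N => k Nk; rewrite -(ler_pM2l c0).
have := sN k Nk; have := sN k.+1 (leqW Nk); have := sdec k; rewrite /= !ltr_norml.
by move=> ? /andP[? ?] /andP[? ?]; lra.
Qed.

(** * Fejer monotonicity and convergence of the iterates *)

Theorem proposition2p6 (R : realType) (n : nat)
    (C : set 'rV[R]_n)
    (C_closed : closed C)
    (C_convex : convex_set (C : set (convex_lmodType 'rV[R]_n)))
    (C_interior : interior C !=set0)
    (h : 'rV[R]_n -> \bar R)
    (h_proper : proper_fun h)
    (h_lsc : lower_semicontinuous h)
    (h_convex : convex_efun h)
    (C_dom_h : C `<=` interior (effective_dom h))
    (h_C1 : continuously_differentiable_on C h)
    (A : 'rV[R]_n -> 'rV[R]_n)
    (A_monotone : monotone_on C A)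
    (A_continuous : {within C, continuous A})
    (sigma beta theta : R)
    (sigma_gt0 : 0 < sigma)
    (beta_01 : 0 < beta < 1)
    (theta_01 : 0 < theta < 1)
    (gamma : nat -> R)
    (gamma_gt0 : forall k, 0 < gamma k)
    (x a z : nat -> 'rV[R]_n)
    (x0_C : C (x 0%N))
    (a_def : forall k, a k = A (x k) + grad h (x k))
    (z_def : forall k, z k = projector C (x k - gamma k *: a k))
    (x_def : forall k,
      x k.+1 = projector C (z k - gamma k *: (A (z k) + grad h (z k) - a k)))
    (solvable : exists xs, is_solution C A h xs)
    (armijo : forall k,
      armijo_goldstein sigma beta theta (fun y => A y + grad h y)
        (indicator_fun C) (x k) (gamma k)) :
  exists xhat : 'rV[R]_n,
    [/\ is_solution C A h xhat,
        op_dom (op_on C A) xhat &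
        x k @[k --> \oo] --> xhat].
Proof.
pose B y := A y + grad h y.
have hNy := h_proper.1.
have domh y : C y -> effective_dom h y by move=> /C_dom_h/nbhs_singleton.
have sub_grad y : C y -> subdifferential h y (grad h y).
  by move=> Cy; apply: grad_subdifferential => //; [exact: domh|exact: h_C1.1].
have B_continuous : {within C, continuous B}.
  move=> y; apply: cvgD; [exact: A_continuous|exact: h_C1.2].
have C_ne : C !=set0 by exists (x 0%N).
have proj_C y : C (projector C y) by have [] := projectorP y C_closed C_ne.
have x_C k : C (x k) by case: k => // k; rewrite x_def.
have z_C k : C (z k) by rewrite z_def.
have zE k : z k = projector C (x k - gamma k *: B (x k)) by rewrite z_def a_def.
have xE k : x k.+1 = projector C (z k - gamma k *: (B (z k) - B (x k))).
  by rewrite x_def a_def.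
(* Adding the subgradient inequalities of [h] at [xs] and at [y] cancels the values of [h];
   monotonicity of [A] and the normal cone inequality give the rest. *)
have sol_dual xs : is_solution C A h xs -> C xs /\
    forall y, C y -> 0 <= dotp (B y) (y - xs).
  case=> _ [v [[_ [u [[Cxs ->] hu ->]]] [_ vN] Au]]; split=> // y Cy.
  have finE q : C q -> h q = (fine (h q))%:E.
    by move=> /domh hq; rewrite fineK// fin_numE hNy lt_eqF.
  have hyx := hu y; have hxy := sub_grad y Cy xs.
  move: hyx hxy; rewrite (finE _ Cxs) (finE _ Cy) -!EFinD !lee_fin.
  have := vN y Cy; have := A_monotone _ _ Cy Cxs.
  have -> : v = - (A xs + u) by apply/eqP; rewrite -addr_eq0 addrC -Au.
  have -> : xs - y = - (y - xs) by rewrite opprB.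
  by rewrite /B !(dotpC _ (y - xs)); move: (y - xs) => d; rewrite !dotpE; lra.
have vi_sol p : C p -> (forall y, C y -> 0 <= dotp (B p) (y - p)) ->
    is_solution C A h p.
  move=> Cp vi; exists (B p), (- B p); split; last by rewrite subrr.
    by exists (A p), (grad h p); split => //; exact: sub_grad.
  by split => // y /vi; rewrite dotpNr dotpC oppr_le0.
have /andP[th0 th1] := theta_01.
have c0 : 0 < 1 - theta ^+ 2 by rewrite subr_gt0 expr_lt1// ltW.
have fejer xs : is_solution C A h xs -> forall k,
    enorm (x k.+1 - xs) ^+ 2 <=
    enorm (x k - xs) ^+ 2 - (1 - theta ^+ 2) * enorm (z k - x k) ^+ 2.
  move=> /sol_dual[Cxs dual] k.
  have := fbf_step (B := B) (x := x k) C_closed C_convex (gamma_gt0 k) Cxs.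
  rewrite /= -zE -xE => /(_ (dual _ (z_C k))).
  (* The accepted Armijo-Goldstein test, with its proximal point identified as [z k]. *)
  have : (gamma k * enorm (B (z k) - B (x k))) ^+ 2 <=
      (theta * enorm (z k - x k)) ^+ 2.
    have [i [gE test _]] := armijo k.
    move: test; rewrite -gE /armijo_test prox_indicator// -zE => test.
    by rewrite lerXn2r// nnegrE mulr_ge0 ?enorm_ge0// ltW.
  by rewrite [(theta * _) ^+ 2]exprMn; lra.
have fejer_le xs : is_solution C A h xs -> forall N k, (N <= k)%N ->
    enorm (x k - xs) <= enorm (x N - xs).
  move=> sxs N k /subnK <-; elim: (k - N)%N => // i; apply: le_trans.
  rewrite addSn -(@ler_pXn2r _ 2)// ?nnegrE ?enorm_ge0//.
  apply: le_trans (fejer xs sxs _) _; rewrite gerBl.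
  by apply: mulr_ge0; [exact: ltW|exact: sqr_ge0].
have [xs sxs] := solvable.
have zx0 e : 0 < e ->
    exists N, forall k, (N <= k)%N -> enorm (z k - x k) <= e.
  move=> e0.
  have [N zxN] := descent_small c0 (fun k => sqr_ge0 (enorm (x k - xs)))
    (fun k => sqr_ge0 (enorm (z k - x k))) (fejer xs sxs) (exprn_gt0 2 e0).
  exists N => k /zxN; rewrite ler_pXn2r// nnegrE ?enorm_ge0// ltW//.
pose K := C `&` [set y | enorm (y - xs) <= enorm (x 0%N - xs)].
(* Fejer monotonicity keeps all iterates in a compact set, which yields the cluster point [p]. *)
have xK : (x @ \oo) K.
  by exists 0%N => // k _; split; [exact: x_C|exact: fejer_le].
have [p [[Cp _] clp]] := compact_enorm_ball C_closed _ xK.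
have xp e N : 0 < e -> exists2 k, (N <= k)%N & enorm (x k - p) < e.
  move=> e0; have xN : (x @ \oo) [set x k | k in [set k | (N <= k)%N]].
    by exists N => // k Nk; exists k.
  have pe : nbhs p [set q | enorm (q - p) < e] by apply/nbhs_enormP; exists e.
  by have [_ [[k Nk <-] xkp]] := clp _ _ xN pe; exists k.
have solp : is_solution C A h p.
  apply: vi_sol => //.
  exact: (armijo_cluster_vi C_closed C_convex B_continuous sigma_gt0 beta_01
    theta_01 x_C zE armijo).
(* Since [p] is itself a solution, distances to [p] do not increase: one iterate within [e] of [p]
   keeps all later ones there. *)
exists p; split => //; first by exists (A p).
move=> U /nbhs_enormP[e e0 eU]; have [N _ xNp] := xp e 0%N e0.
by exists N => // k Nk; apply: eU; exact: le_lt_trans (fejer_le _ solp _ _ Nk) xNp.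
Qed.
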